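(* Let $X$ be a topological space, $\mathcal F$ a family of subsets of $X$, and $\lambda$ a regular cardinal. Then the following conditions are equivalent. (a) $X$ is $\mathcal F$-$[\lambda,\lambda]$-compact. (b) Whenever $(C_\alpha)_{\alpha\in\lambda}$ is a family of closed sets of $X$ such that $C_\alpha\supseteq C_\beta$ for all $\alpha\le\beta<\lambda$, and for every $\alpha\in\lambda$ there exists $F\in\mathcal F$ with $C_\alpha\supseteq F$, then $\bigcap_{\alpha\in\lambda}C_\alpha\ne\emptyset$. (b$_1$) Whenever $(C_\alpha)_{\alpha\in\lambda}$ is a family of closed sets of $X$ such that $C_\alpha\supseteq C_\beta$ for all $\alpha\le\beta<\lambda$, each $C_\alpha$ is the closure of the union of some set of members of $\mathcal F$, and for every $\alpha\in\lambda$ there exists $F\in\mathcal F$ with $C_\alpha\supseteq F$, then $\bigcap_{\alpha\in\lambda}C_\alpha\ne\emptyset$. (b$_2$) Whenever $(C_\alpha)_{\alpha\in\lambda}$ is a family of closed sets of $X$ such that $C_\alpha\supseteq C_\beta$ for all $\alpha\le\beta<\lambda$, each $C_\alpha$ is the closure of the union of some set of at most $\lambda$ members of $\mathcal F$, and for every $\alpha\in\lambda$ there exists $F\in\mathcal F$ with $C_\alpha\supseteq F$, then $\bigcap_{\alpha\in\lambda}C_\alpha\ne\emptyset$. (c) Every sequence $(F_\alpha)_{\alpha\in\lambda}$ of elements of $\mathcal F$ has a $\lambda$-complete accumulation point in $X$ (that is, $X$ satisfies $\mathcal F$-$\mathrm{CAP}^*_\lambda$). (d) For every sequence $(F_\alpha)_{\alpha\in\lambda}$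 of elements of $\mathcal F$ there exists some ultrafilter $D$ uniform over $\lambda$ such that $(F_\alpha)_{\alpha\in\lambda}$ has a $D$-limit point in $X$. (e) For every $\lambda$-indexed open cover $(O_\alpha)_{\alpha\in\lambda}$ of $X$ there exists $Z\subseteq\lambda$ with $|Z|<\lambda$ such that, for every $F\in\mathcal F$, $F\cap\bigcup_{\alpha\in Z}O_\alpha\ne\emptyset$. (f) For every $\lambda$-indexed open cover $(O_\alpha)_{\alpha\in\lambda}$ of $X$ such that $O_\alpha\subseteq O_\beta$ whenever $\alpha\le\beta<\lambda$, there exists $\alpha\in\lambda$ such that $O_\alpha$ intersects each $F\in\mathcal F$. Moreover, in each of the conditions (a), (b), (b$_1$), (b$_2$), (c), (d), (e), (f) one can equivalently replace $\mathcal F$ by $\overline{\mathcal F}=\{\overline F\mid F\in\mathcal F\}$. Also, if $\mathcal G$ is a family of subsets of $X$ with $\mathcal F\rhd\mathcal G$ and $\mathcal G\rhd\mathcal F$, then in each of the conditions (a), (b), (b$_1$), (b$_2$), (c), (d), (e), (f) one can equivalently replace $\mathcal F$ by $\mathcal G$.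
   Context: No separation axioms are assumed. Regular cardinals are infinite. An ultrafilter $D$ over an infinite cardinal $\lambda$ is uniform if every member of $D$ has cardinality $\lambda$. For infinite cardinals $\mu,\lambda$, $X$ is $\mathcal F$-$[\mu,\lambda]$-compact if: for every family $(C_\alpha)_{\alpha\in\lambda}$ of closed sets of $X$, if for every $Z\subseteq\lambda$ with $|Z|<\mu$ there exists $F\in\mathcal F$ such that $\bigcap_{\alpha\in Z}C_\alpha\supseteq F$, then $\bigcap_{\alpha\in\lambda}C_\alpha\neq\emptyset$ (the intersection over $Z=\emptyset$ is $X$). Let $(Y_\alpha)_{\alpha\in\lambda}$ be a sequence of subsets of $X$ (repetitions allowed). A point $x\in X$ is a $\lambda$-complete accumulation point of it if $|\{\alpha\in\lambda\mid Y_\alpha\cap U\neq\emptyset\}|=\lambda$ for every neighborhood $U$ of $x$. If $D$ is an ultrafilter over $\lambda$, $x$ is a $D$-limit point of it if $\{\alpha\in\lambda\mid Y_\alpha\cap U\ne\emptyset\}\in D$ for every neighborhood $U$ of $x$. For families $\mathcal F,\mathcal G$ of subsets of $X$, $\mathcal F\rhd\mathcal G$ means that for every $F\in\mathcal F$ there is $G\in\mathcal G$ with $F\supseteq G$. *)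

(* Defs.v *)
From mathcomp Require Import all_boot all_order.
From mathcomp Require Import boolp classical_sets functions cardinality.
From mathcomp Require Import wochoice filter topology.

Set Implicit Arguments.
Unset Strict Implicit.
Unset Printing Implicit Defensive.

Local Open Scope classical_set_scope.
Local Open Scope card_scope.
Local Open Scope order_scope.

Definition card_lt {T U : Type} (A : set T) (B : set U) : Prop :=
  A #<= B /\ ~ (B #<= A).

Definition cofinal {d : Order.disp_t} {L : porderType d} (A : set L) : Prop :=
  forall a : L, exists2 b, A b & a <= b.

(* A cardinal is an initial ordinal, presented here up to isomorphism as a
   well-ordered type L all of whose proper initial segments have smaller
   cardinality than L; [card_regular] says that the cofinality of L is |L|. *)
Record regular_cardinal {d : Order.disp_t} (L : orderType d) : Prop := {
  card_well_ordered : well_order (<=%O : rel L) ;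
  card_initial : forall a : L, card_lt [set b | b < a] [set: L] ;
  card_infinite : infinite_set [set: L] ;
  card_regular : forall A : set L, cofinal A -> A #= [set: L] }.

(* The cardinals mu and lambda are given by the types M and L. *)
Definition fam_compact (M L : Type) (X : topologicalType) (F : set (set X)) :
    Prop :=
  forall C : L -> set X, (forall a, closed (C a)) ->
    (forall Z : set L, card_lt Z [set: M] ->
      exists2 A, F A & A `<=` \bigcap_(a in Z) C a) ->
    \bigcap_a C a !=set0.

Definition complete_accumulation_point (L : Type) (X : topologicalType)
    (Y : L -> set X) (x : X) : Prop :=
  forall U, nbhs x U -> [set a | Y a `&` U !=set0] #= [set: L].

Definition D_limit_point (L : Type) (X : topologicalType) (D : set_system L)
    (Y : L -> set X) (x : X) : Prop :=
  forall U, nbhs x U -> D [set a | Y a `&` U !=set0].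

Definition uniform_over (L : Type) (D : set_system L) : Prop :=
  forall A, D A -> A #= [set: L].

Definition refines (X : Type) (F G : set (set X)) : Prop :=
  forall A, F A -> exists2 B, G B & B `<=` A.

Section Conditions.
Context {d : Order.disp_t} (L : orderType d) {X : topologicalType}.
Implicit Types (F : set (set X)) (C O Y : L -> set X).

Definition decreasing_fam C : Prop := forall a b, a <= b -> C b `<=` C a.

Definition increasing_fam O : Prop := forall a b, a <= b -> O a `<=` O b.

Definition cond_a F : Prop := fam_compact L L F.

Definition cond_b F : Prop :=
  forall C, (forall a, closed (C a)) -> decreasing_fam C ->
    (forall a, exists2 A, F A & A `<=` C a) ->
    \bigcap_a C a !=set0.

Definition cond_b1 F : Prop :=
  forall C, (forall a, closed (C a)) -> decreasing_fam C ->
    (forall a, exists2 H : set (set X), H `<=` F &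
      C a = closure (\bigcup_(A in H) A)) ->
    (forall a, exists2 A, F A & A `<=` C a) ->
    \bigcap_a C a !=set0.

Definition cond_b2 F : Prop :=
  forall C, (forall a, closed (C a)) -> decreasing_fam C ->
    (forall a, exists H : set (set X),
      [/\ H `<=` F, H #<= [set: L] & C a = closure (\bigcup_(A in H) A)]) ->
    (forall a, exists2 A, F A & A `<=` C a) ->
    \bigcap_a C a !=set0.

Definition cond_c F : Prop :=
  forall Y, (forall a, F (Y a)) -> exists x, complete_accumulation_point Y x.

Definition cond_d F : Prop :=
  forall Y, (forall a, F (Y a)) ->
    exists D : set_system L,
      [/\ UltraFilter D, uniform_over D & exists x, D_limit_point D Y x].

Definition cond_e F : Prop :=
  forall O, (forall a, open (O a)) -> \bigcup_a O a = [set: X] ->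
    exists2 Z : set L, card_lt Z [set: L] &
      forall A, F A -> A `&` \bigcup_(a in Z) O a !=set0.

Definition cond_f F : Prop :=
  forall O, (forall a, open (O a)) -> \bigcup_a O a = [set: X] ->
    increasing_fam O ->
    exists a, forall A, F A -> A `&` O a !=set0.

Definition interchangeable F G : Prop :=
  (cond_a F <-> cond_a G) /\ (cond_b F <-> cond_b G) /\
  (cond_b1 F <-> cond_b1 G) /\ (cond_b2 F <-> cond_b2 G) /\
  (cond_c F <-> cond_c G) /\ (cond_d F <-> cond_d G) /\
  (cond_e F <-> cond_e G) /\ (cond_f F <-> cond_f G).

End Conditions.

(* Main.v *)
(** For regular [L], a subset of [L] has cardinality [|L|] exactly when it is
    unbounded.  Hence small index sets can be replaced by proper initial
    segments, and arbitrary families of closed (open) sets by decreasing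
    (increasing) ones; accumulation at [x] says that each neighborhood of [x]
    meets unboundedly many terms, so together with the final segments of [L]
    these index sets generate a filter, and every ultrafilter extending it is
    uniform. *)

Require Import Defs.
From mathcomp Require Import all_boot all_order.
From mathcomp Require Import boolp classical_sets functions cardinality.
From mathcomp Require Import wochoice filter topology.

Local Open Scope classical_set_scope.

Set Implicit Arguments.
Unset Strict Implicit.
Unset Printing Implicit Defensive.

Import Order.TTheory.

(** * Cofinality and cardinality of subsets of a regular cardinal *)

Lemma not_cofinal_bounded (d : Order.disp_t) (L : orderType d) (A : set L) :
  ~ cofinal A -> exists a, A `<=` [set b | (b < a)%O].
Proof.
move=> nA; apply: contrapT => nbnd; apply: nA => a; apply: contrapT => nb.
apply: nbnd; exists a => b Ab /=; rewrite ltNge; apply/negP => ab.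
by apply: nb; exists b.
Qed.

(** A bounded set lies in a proper initial segment, which is strictly smaller than [L] because [L]
    is an initial ordinal. *)
Lemma card_eqT_cofinal (d : Order.disp_t) (L : orderType d) (A : set L) :
  regular_cardinal L -> (A #= [set: L])%card -> cofinal A.
Proof.
move=> regL AL; apply: contrapT => /not_cofinal_bounded[a Aa].
have [_] := card_initial regL a; apply.
by move: AL => /card_eqPle[_ LA]; exact: card_le_trans LA (subset_card_le Aa).
Qed.

Lemma card_lt_bounded (d : Order.disp_t) (L : orderType d) (Z : set L) :
  regular_cardinal L -> card_lt Z [set: L] ->
  exists a, Z `<=` [set b | (b < a)%O].
Proof.
move=> regL [_ nLZ]; apply: not_cofinal_bounded => /(card_regular regL).
by move=> /card_eqPle[_].
Qed.

Lemma regular_inhabited (d : Order.disp_t) (L : orderType d) :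
  regular_cardinal L -> exists a : L, True.
Proof.
move=> regL; apply: contrapT => nL; apply: (card_infinite regL).
suff -> : [set: L] = set0 by exact: finite_set0.
by apply/seteqP; split => a // _; apply: nL; exists a.
Qed.

Lemma regular_no_max (d : Order.disp_t) (L : orderType d) (a : L) :
  regular_cardinal L -> exists b, (a < b)%O.
Proof.
move=> regL.
(* If [a] were a maximum, its singleton would be cofinal, so by regularity [L] would be finite. *)
have [|b ab] := @not_cofinal_bounded _ _ [set a]; last by exists b; exact: ab.
move=> /(card_regular regL) /card_eqPle[_ La].
exact/(card_infinite regL)/(card_le_finite La)/finite_set1.
Qed.

Lemma cofinal_tails_uniform (d : Order.disp_t) (L : orderType d)
    (D : set_system L) :
  regular_cardinal L -> ProperFilter D ->
  (forall a : L, D [set b | (a <= b)%O]) -> uniform_over D.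
Proof.
move=> regL DF Dtail A DA; apply: (card_regular regL) => a.
by have [b [Ab ab]] := filter_ex (filterI DA (Dtail a)); exists b.
Qed.

Lemma complete_accumulation_D_limit (d : Order.disp_t) (L : orderType d)
    (X : topologicalType) (Y : L -> set X) (x : X) :
  regular_cardinal L -> complete_accumulation_point Y x ->
  exists D : set_system L,
    [/\ UltraFilter D, uniform_over D & D_limit_point D Y x].
Proof.
move=> regL accx.
pose I := [set p : set X * L | nbhs x p.1].
(* Cutting with a final segment is what forces uniformity; these sets are nonempty because
   accumulation makes the first factor cofinal. *)
pose B (p : set X * L) :=
  [set b | Y b `&` p.1 !=set0] `&` [set b | (p.2 <= b)%O].
have [a0 _] := regular_inhabited regL.
have PB : ProperFilter (filter_from I B).
  apply: filter_from_proper; last first.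
    move=> [U a] /= xU.
      have [b Yb ab] := card_eqT_cofinal regL (accx U xU) a.
    by exists b.
  apply: filter_from_filter; first by exists (setT, a0); exact: filterT.
  move=> [U a] [V b] /= xU xV; exists (U `&` V, Order.max a b).
    exact: filterI.
  move=> c [/= [y [Yy [Uy Vy]]]]; rewrite ge_max => /andP[ac bc].
  by split; split => //; exists y.
have [D [DU BD]] := ultraFilterLemma PB; exists D; split => //.
- apply: cofinal_tails_uniform => // a; apply: BD.
  by exists (setT, a) => [|b []//]; exact: filterT.
- move=> U xU; apply: BD.
  by exists (U, a0) => // b [].
Qed.

(** * The cycle of implications *)

Lemma cond_a_b (d : Order.disp_t) (L : orderType d) (X : topologicalType)
    (F : set (set X)) :
  regular_cardinal L -> cond_a L F -> cond_b L F.
Proof.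
move=> regL condF C clC decC FC; apply: condF => // Z Zlt.
have [a Za] := card_lt_bounded regL Zlt; have [A FA AC] := FC a.
by exists A => // x Ax b /Za /ltW ba; exact: decC ba _ (AC _ Ax).
Qed.

Lemma cond_b_b1 (d : Order.disp_t) (L : orderType d) (X : topologicalType)
    (F : set (set X)) :
  cond_b L F -> cond_b1 L F.
Proof. by move=> condF C clC decC _; exact: condF. Qed.

Lemma cond_b1_b2 (d : Order.disp_t) (L : orderType d) (X : topologicalType)
    (F : set (set X)) :
  cond_b1 L F -> cond_b2 L F.
Proof.
move=> condF C clC decC HC; apply: condF => // a.
by have [H [HF _ CH]] := HC a; exists H.
Qed.

(** Take the closures of the unions of the tails of [Y]. A neighborhood of a point common to all of
    them meets terms of arbitrarily large index. *)
Lemma cond_b2_c (d : Order.disp_t) (L : orderType d) (X : topologicalType)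
    (F : set (set X)) :
  regular_cardinal L -> cond_b2 L F -> cond_c L F.
Proof.
move=> regL condF Y FY.
pose T (a : L) := [set b | (a <= b)%O].
have [|a b ab||a|x Cx] :=
    condF (fun a => closure (\bigcup_(A in Y @` T a) A)).
- by move=> a; exact: closed_closure.
- apply: closureS => x [_ [c bc <-] Yx].
  by exists (Y c) => //; exists c => //; exact: le_trans bc.
- move=> a; exists (Y @` T a); split => //.
  + by move=> _ [b _ <-].
  + exact: card_le_trans (card_image_le _ _) (subset_card_le (@subsetT _ _)).
- exists (Y a) => //; apply: subset_trans (@subset_closure _ _) => x Yx.
  by exists (Y a) => //; exists a => //; exact: lexx.
- exists x => U xU; apply: (card_regular regL) => a.
  have [y [[_ [b ab <-] Yy] Uy]] := Cx a I U xU.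
  by exists b => //; exists y.
Qed.

Lemma cond_c_d (d : Order.disp_t) (L : orderType d) (X : topologicalType)
    (F : set (set X)) :
  regular_cardinal L -> cond_c L F -> cond_d L F.
Proof.
move=> regL condF Y /condF[x /(complete_accumulation_D_limit regL)].
by move=> [D [DU Dunif Dx]]; exists D; split => //; exists x.
Qed.

(** By contradiction: initial segments are small, so some [Y a] in [F] misses every [O b] with
    [b < a]. A limit point lies in one [O a], which then meets unboundedly many terms of [Y]. *)
Lemma cond_d_e (d : Order.disp_t) (L : orderType d) (X : topologicalType)
    (F : set (set X)) :
  regular_cardinal L -> cond_d L F -> cond_e L F.
Proof.
move=> regL condF O opO covO; apply: contrapT => ncov.
have missing (a : L) : exists A, F A /\
    ~ (A `&` \bigcup_(b in [set b | (b < a)%O]) O b !=set0).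
  apply: contrapT => nA; apply: ncov; exists [set b | (b < a)%O].
    exact: card_initial.
  by move=> A FA; apply: contrapT => nAO; apply: nA; exists A.
have [Y YP] := choice missing.
have [D [_ Dunif [x Dx]]] := condF Y (fun a => (YP a).1).
have [a _ Oax] : (\bigcup_a O a) x by rewrite covO.
have /Dunif/(card_eqT_cofinal regL) cofS :=
  Dx _ (open_nbhs_nbhs (conj (opO a) Oax)).
(* [Y b] avoids [O a] only for [a < b], so cofinality is applied strictly above [a]. *)
have [c ac] := regular_no_max a regL.
have [b [y [Yy Oy]] cb] := cofS c.
apply: (YP b).2; exists y; split => //.
by exists a => //; exact: lt_le_trans cb.
Qed.

Lemma cond_e_f (d : Order.disp_t) (L : orderType d) (X : topologicalType)
    (F : set (set X)) :
  regular_cardinal L -> cond_e L F -> cond_f L F.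
Proof.
move=> regL condF O opO covO incO; have [Z Zlt FZ] := condF O opO covO.
have [a Za] := card_lt_bounded regL Zlt; exists a => A /FZ[x [Ax [b Zb Ox]]].
by exists x; split => //; exact: incO (ltW (Za _ Zb)) _ Ox.
Qed.

Lemma cond_f_a (d : Order.disp_t) (L : orderType d) (X : topologicalType)
    (F : set (set X)) :
  regular_cardinal L -> cond_f L F -> cond_a L F.
Proof.
move=> regL condF C clC FC; apply: contrapT => C0.
(* If the whole family has empty intersection, the complements of these partial intersections form
   an increasing open cover. *)
pose K a := \bigcap_(b in [set b | (b < a)%O]) C b.
have [||a b ab|a aP] := condF (fun a => ~` K a).
- by move=> a; apply: closed_openC; exact: closed_bigI.
- apply/seteqP; split => // x _; apply: contrapT => nx; apply: C0; exists x.
  move=> a _; have [b ab] := regular_no_max a regL.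
  apply: contrapT => nCx; apply: nx; exists b => //.
  by move=> /(_ a ab).
- move=> x nKx Kx; apply: nKx => c ca.
  by apply: Kx; exact: lt_le_trans ab.
(* The segment below [a] is small, so [K a] contains a member of [F], which cannot meet its
   complement. *)
- have [A FA AK] := FC _ (card_initial regL a).
  by have [x [Ax]] := aP A FA; apply; exact: AK.
Qed.

Lemma cond_equivalent (d : Order.disp_t) (L : orderType d)
    (X : topologicalType) (F : set (set X)) :
  regular_cardinal L ->
  [<-> cond_a L F; cond_b L F; cond_b1 L F; cond_b2 L F;
       cond_c L F; cond_d L F; cond_e L F; cond_f L F].
Proof.
move=> regL; tfae.
- exact: cond_a_b.
- exact: cond_b_b1.
- exact: cond_b1_b2.
- exact: cond_b2_c.
- exact: cond_c_d.
- exact: cond_d_e.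
- exact: cond_e_f.
- exact: cond_f_a.
Qed.

(** * Replacing the family [F] *)

Lemma cond_b_interchangeable (d : Order.disp_t) (L : orderType d)
    (X : topologicalType) (F G : set (set X)) :
  regular_cardinal L -> (cond_b L F <-> cond_b L G) -> interchangeable L F G.
Proof.
move=> regL FG.
have EF := cond_equivalent F regL.
have EG := cond_equivalent G regL.
(* Every transfer passes through [cond_b], at position 1 counting from 0; there [F] enters only
   through which closed sets contain a member of it. *)
have tr i := iff_trans (EF i 1) (iff_trans FG (EG 1 i)).
by split; [exact: (tr 0)|split; [exact: (tr 1)|split; [exact: (tr 2)|split;
  [exact: (tr 3)|split; [exact: (tr 4)|split; [exact: (tr 5)|split;
  [exact: (tr 6)|exact: (tr 7)]]]]]]].
Qed.

Lemma cond_b_refines (d : Order.disp_t) (L : orderType d)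
    (X : topologicalType) (F G : set (set X)) :
  refines G F -> cond_b L F -> cond_b L G.
Proof.
move=> GF condF C clC decC GC; apply: condF => // a.
have [B GB BC] := GC a; have [A FA AB] := GF B GB.
by exists A => //; exact: subset_trans BC.
Qed.

Lemma cond_b_closure (d : Order.disp_t) (L : orderType d)
    (X : topologicalType) (F : set (set X)) :
  cond_b L F <-> cond_b L [set closure A | A in F].
Proof.
split; first by apply: cond_b_refines => _ [A FA <-]; exists A => //;
  exact: subset_closure.
move=> condF C clC decC FC; apply: condF => // a.
have [A FA AC] := FC a; exists (closure A); first by exists A.
(* A closed set containing [A] contains its closure. *)
by rewrite (closure_id (C a)).1//; exact: closureS.
Qed.

Theorem theorem4p4 (d : Order.disp_t) (L : orderType d) (X : topologicalType)
    (F : set (set X)) (regL : regular_cardinal L) :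
  [/\ [<-> cond_a L F; cond_b L F; cond_b1 L F; cond_b2 L F;
           cond_c L F; cond_d L F; cond_e L F; cond_f L F],
      interchangeable L F [set closure A | A in F] &
      forall G : set (set X), refines F G -> refines G F ->
        interchangeable L F G].
Proof.
split.
- exact: cond_equivalent.
- by apply: cond_b_interchangeable => //; exact: cond_b_closure.
- move=> G FG GF; apply: cond_b_interchangeable => //.
  by split; exact: cond_b_refines.
Qed.
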